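(* Let $n,r$ be positive integers. (i) For $1\leq r\leq d_{n+1}$, the set $\mathcal{P}(|s_n^r|;2)$ equals $\{C_j(s_n^r):0\leq j\leq |s_n|-1\}$ if $1\leq r<1+d_{n+1}/2$; equals $\{C_j(s_n^r):0\leq j\leq |D_{n-k}|\}$ if $d_{n+1}$ is even and $r=1+d_{n+1}/2$; and is empty if $1+d_{n+1}/2<r\leq d_{n+1}$. Correspondingly $p(|s_n^r|;2)$ equals $|s_n|$, $|D_{n-k}|+1$, $0$ respectively in these three cases. (ii) For $1\leq r\leq d_{n+1}$ and $i\in[2,k]$ (with $r\neq d_{n+1}$ if $i=k$), writing $v=s_n^r s_{n-1}^{d_n}\cdots s_{n+2-i}^{d_{n+3-i}}s_{n+1-i}$, we have $\mathcal{P}(|v|;2)=\{C_j(v):0\leq j\leq |D_{n+1-i}|\}$ and $p(|v|;2)=|D_{n+1-i}|+1$.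
   Context: Fix $k\geq 2$ and the alphabet $\mathcal{A}_k=\{a_1,\dots,a_k\}$. An infinite word $\mathbf{t}$ is standard episturmian with directive word $x_1x_2x_3\cdots$ ($x_i$ letters) if its palindromic prefixes $u_1=\varepsilon,u_2,\dots$ satisfy $u_{n+1}=(u_nx_n)^{(+)}$, where $w^{(+)}$ is the shortest palindrome having $w$ as a prefix, and $\mathbf{t}=\lim_n u_n$. Let $(d_i)_{i\geq1}$ be positive integers and let $\mathbf{s}$ be the standard episturmian word with directive word $a_1^{d_1}a_2^{d_2}\cdots a_k^{d_k}a_1^{d_{k+1}}\cdots a_k^{d_{2k}}a_1^{d_{2k+1}}\cdots$. Define $s_{1-k}=a_2,\dots,s_{-1}=a_k,s_0=a_1$; $s_n=s_{n-1}^{d_n}\cdots s_0^{d_1}a_{n+1}$ for $1\leq n\leq k-1$; $s_n=s_{n-1}^{d_n}s_{n-2}^{d_{n-1}}\cdots s_{n-k+1}^{d_{n-k+2}}s_{n-k}$ for $n\geq k$. Define $D_0=a_1^{d_1-1}$, $D_m=s_m^{d_{m+1}-1}s_{m-1}^{d_m}\cdots s_1^{d_2}s_0^{d_1}$ for $m\geq1$, and for $1\leq j\leq k$ set formally $D_{-j}=a_{k+1-j}^{-1}$ with $|D_{-j}|=-1$. For a word $w=x_1\cdots x_m$ and $0\leq j\leq m-1$, $C_j(w)=x_{j+1}\cdots x_mx_1\cdots x_j$ is its $j$-th conjugate. For $m\geq1,l\geq2$, $\mathcal{P}(m;l)$ is the set of words $w$ with $|w|=m$ such that $w^l$ is a factor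 of $\mathbf{s}$, and $p(m;l)=|\mathcal{P}(m;l)|$.
   Formalization: In (ii), when n+1-i<0, the formal theorem also assumes d_{n+1} ≤ 2r and r < d_{n+1}; the excluded instances are false by (i), since then |v|=|s_n^{r+1}|. If n+2-i<0, the product in v stops at s_0^{d_1}, because d_j is undefined for j ≤ 0. *)

(* Defs.v *)
From mathcomp Require Import all_boot all_order all_algebra.
From mathcomp Require Import boolp classical_sets.

Set Implicit Arguments.
Unset Strict Implicit.
Unset Printing Implicit Defensive.

Import Order.TTheory GRing.Theory Num.Theory.

Local Open Scope classical_set_scope.

Section Words.
Variable A : finType.
Implicit Types (w p : seq A) (x t : nat -> A).

Definition wpow w l : seq A := flatten (nseq l w).

Definition palindrome w : Prop := rev w = w.

(* [p] is w^(+), the shortest palindrome having [w] as a prefix. *)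
Definition is_pal_closure w p : Prop :=
  [/\ palindrome p, prefix w p
    & forall q, palindrome q -> prefix w q -> size p <= size q].

(* t = lim u_n, letter by letter. *)
Definition word_lim (u : nat -> seq A) t : Prop :=
  forall i, exists N, forall n, N <= n ->
    i < size (u n) /\ nth (t i) (u n) i = t i.

(* [x 0], [x 1], ... and [u 0], [u 1], ... are the x_1, x_2, ... and
   u_1, u_2, ... of the usual 1-based numbering. The u_n are automatically
   palindromic prefixes of [t]. *)
Definition standard_episturmian x t : Prop :=
  exists u : nat -> seq A,
    [/\ u 0 = [::],
        forall n, is_pal_closure (rcons (u n) (x n)) (u n.+1)
      & word_lim u t].

Definition is_factor w t : Prop :=
  exists i, w = mkseq (fun j => t (i + j)) (size w).

(* P(m;l) and p(m;l) *)
Definition Ppow t (m l : nat) : set (seq A) :=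
  [set w | size w = m /\ is_factor (wpow w l) t].

Definition ppow t (m l : nat) : nat :=
  #|[pred w : m.-tuple A | `[< Ppow t m l w >]]|.

(* {C_j(w) : 0 <= j <= b}; empty for b < 0. The conjugate C_j is [rot j]. *)
Definition conjugates w (b : int) : set (seq A) :=
  [set rot j w | j in [set j : nat | (j%:Z <= b)%R]].

End Words.

Section StandardWords.
Variables (k : nat) (hk : 1 < k).

(* The letter a_i, 1 <= i <= k, with indices read modulo k: a_(k+1) = a_1. *)
Definition letter (i : nat) : 'I_k := Ordinal (ltn_pmod i.-1 (ltnW hk)).

(* [d i] is d_i for i >= 1; [d 0] is never used. *)
Variable d : nat -> nat.

(* x is a_1^(d_1) a_2^(d_2) a_3^(d_3) ..., with the indices of the letters
   taken modulo k; since the d_i are positive this determines x. *)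
Definition is_directive (x : nat -> 'I_k) : Prop :=
  forall m j, j < d m.+1 -> x ((\sum_(1 <= i < m.+1) d i) + j) = letter m.+1.

(* [:: s_n; s_(n-1); ...; s_0] *)
Fixpoint shist (n : nat) : seq (seq 'I_k) :=
  if n is n'.+1 then
    let h := shist n' in
    (flatten [seq wpow (nth [::] h l) (d (n - l)) | l <- iota 0 (minn k.-1 n)]
       ++ (if n < k then [:: letter n.+1] else nth [::] h k.-1)) :: h
  else [:: [:: letter 1]].

(* s_n for all n >= 1 - k: [Negz j] is -(j+1), and s_(-j) = a_(k+1-j). *)
Definition sw (n : int) : seq 'I_k :=
  match n with
  | Posz n => head [::] (shist n)
  | Negz j => [:: letter (k - j)]
  end.

(* s_(n-1)^(d_n) s_(n-2)^(d_(n-1)) ..., with c factors (c <= n). *)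
Definition sprod (n c : nat) : seq 'I_k :=
  flatten [seq wpow (sw (n.-1 - l)%N) (d (n - l)) | l <- iota 0 c].

(* D_m as a word for m >= 0 ([inl]), as a formal inverse letter for m < 0
   ([inr], D_(-j) being the inverse of a_(k+1-j)). *)
Definition D (m : int) : seq 'I_k + 'I_k :=
  match m with
  | Posz m => inl (wpow (sw m) (d m.+1 - 1) ++ sprod m m)
  | Negz j => inr (letter (k - j))
  end.

Definition Dlen (m : int) : int :=
  match D m with inl w => (size w)%:Z | inr _ => (-1)%R end.

(* s_n^r s_(n-1)^(d_n) ... s_(n+2-i)^(d_(n+3-i)) s_(n+1-i); as in the definition
   of s_n for n < k, the product of powers stops at s_0^(d_1). *)
Definition vword (n r i : nat) : seq 'I_k :=
  wpow (sw n) r ++ sprod n (minn (i - 2) n) ++ sw (n%:Z + 1 - i%:Z)%R.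

Lemma size_shist n : size (shist n) = n.+1.
Proof. by elim: n => //= n ->. Qed.

Lemma nth_shist n l : l <= n -> nth [::] (shist n) l = sw (n - l)%N.
Proof.
by elim: n l => [|n IHn] [|l] //= hl; rewrite IHn.
Qed.

(* The defining recurrences of the s_n. *)
Lemma sw_small n : 0 < n < k -> sw n = sprod n n ++ [:: letter n.+1].
Proof.
case: n => // n /= hn; rewrite hn /sprod (minn_idPr _); last first.
  by rewrite -ltnS prednK // (ltn_trans _ hk).
congr (flatten _ ++ _); apply/eq_in_map => l; rewrite mem_iota /= add0n => hl.
by rewrite nth_shist.
Qed.

Lemma sw_large n : k <= n -> sw n = sprod n k.-1 ++ sw (n - k)%N.
Proof.
case: n => [|n] hn; first by move: (leq_trans hk hn).
have hk0 : 0 < k := ltnW hk.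
rewrite {1}/sw [head _ _]/= ltnNge hn /= /sprod (minn_idPl _); last first.
  by rewrite (leq_trans (leq_pred k)).
have hkn : k.-1 <= n by rewrite -ltnS prednK.
have eqk : n - k.-1 = n.+1 - k by case: (k) hk0.
congr (flatten _ ++ _); last by rewrite nth_shist // eqk.
apply/eq_in_map => l; rewrite mem_iota /= add0n => hl.
by rewrite nth_shist // ltnW // (leq_trans hl).
Qed.

(* The initial values s_(1-k) = a_2, ..., s_(-1) = a_k. *)
Lemma sw_neg j : 0 < j < k -> sw (- j%:Z)%R = [:: letter (k.+1 - j)].
Proof. by case: j => // j _; rewrite -NegzE /= subSS. Qed.

End StandardWords.

(* Main.v *)
Require Import Defs.
From mathcomp Require Import all_boot all_order all_algebra.
From mathcomp Require Import boolp classical_sets.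
From mathcomp Require Import zify.

(* Write psi_a for the morphism fixing a and sending every other letter b to ab,
   and Psi_j for the composition of the psi_(x_i), i < j. By Justin's formula
   s = Psi_j(T_j), where T_j is the standard episturmian word with directive word
   x_j x_(j+1) ..., and the palindromic prefix u_j of s occurs at every position
   where a block Psi_j(b) starts. Two occurrences of the same factor of s can be
   desubstituted until the factor is exhausted, hence they lie at the same place
   in two occurrences of some u_j at block boundaries. A square of period m thus
   comes from a factor f of T_j with m = |Psi_j(f)| <= |u_j|. Since
   |u_j| < |Psi_j(b)| + |Psi_j(c)| for distinct letters b and c, f is a power of
   a letter, and the squares it yields are the conjugates C_i(Psi_j(f)) with
   i <= |u_j| - m. For the cyclic directive word Psi_j(b) is one of the words
   s_n, v, and |u_j| - |Psi_j(b)| is the length of the palindromic prefix reached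
   just before the last use of b, which is D_m. Comparing lengths shows that m
   determines f, and primitivity of Psi_j(b) makes the conjugates distinct. *)

Set Implicit Arguments.
Unset Strict Implicit.
Unset Printing Implicit Defensive.

(** * The morphism psi_a and palindromic closure *)

Section Psi.
Variable A : finType.
Implicit Types (a b c : A) (w p q u y : seq A).

Definition block a b : seq A := if b == a then [:: a] else [:: a; b].

Definition psi a w : seq A := flatten [seq block a b | b <- w].

Lemma prefix_cat u p : prefix u p -> exists y, p = u ++ y.
Proof. by case/prefixP=> y ->; exists y. Qed.

Lemma psi_cons a b w : psi a (b :: w) = block a b ++ psi a w.
Proof. by []. Qed.

Lemma psi_cat a u w : psi a (u ++ w) = psi a u ++ psi a w.
Proof. by rewrite /psi map_cat flatten_cat. Qed.

(** The mirror of [psi a] codes a letter b other than [a] as ba instead of ab. The two codings are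
    conjugate by [a], which the appended [a] absorbs. *)
Lemma psi_rev a w : rcons (psi a (rev w)) a = rev (rcons (psi a w) a).
Proof.
rewrite rev_rcons; elim: w => [|b w IH] //=.
rewrite psi_cons rev_cons -(cats1 (rev w)) psi_cat rev_cat -cat_cons -IH -!cats1 -!catA.
by congr cat; rewrite /psi /= /block; case: eqP.
Qed.

Lemma size_psi_rev a w : size (psi a (rev w)) = size (psi a w).
Proof.
by move: (congr1 size (psi_rev a w)); rewrite size_rev !size_rcons => -[].
Qed.

Lemma leq_size_psi a w : size w <= size (psi a w).
Proof.
elim: w => [|b w IH] //; rewrite psi_cons size_cat /block.
by case: eqP => _ /=; lia.
Qed.

Lemma psi_head a w : exists u, rcons (psi a w) a = a :: u.
Proof.
case: w => [|b w]; first by exists [::].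
rewrite psi_cons /block; case: eqP => _ /=; first by exists (rcons (psi a w) a).
by exists (b :: rcons (psi a w) a).
Qed.

Lemma psi_inj a : injective (psi a).
Proof.
elim=> [|b u IH] [|c w] //; rewrite ?psi_cons /block; try by case: eqP.
have [[u' eu] [w' ew]] := (psi_head a u, psi_head a w).
case: (eqVneq b a) => [->|nb]; case: (eqVneq c a) => [->|nc] //= [].
- by move/IH ->.
- by move=> e; move: ew eu; rewrite e /= => _ [/eqP]; rewrite (negPf nc).
- by move=> e; move: eu ew; rewrite -e /= => _ [/eqP]; rewrite (negPf nb).
- by move=> -> /IH ->.
Qed.

Lemma psi_split a w i : i < size (psi a w) -> nth a (psi a w) i = a ->
  exists i', [/\ i' < size w, take i (psi a w) = psi a (take i' w)
               & drop i (psi a w) = psi a (drop i' w)].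
Proof.
elim: w i => [|b w IH] [|i] //; first by exists 0; rewrite take0 drop0.
rewrite psi_cons /block; case: (eqVneq b a) => [->|nb] /=.
  move=> /IH h /h [i' [lt et ed]]; exists i'.+1; split=> //.
  by rewrite et /= psi_cons /block eqxx.
case: i => [|i] /= => [_ eb|]; first by rewrite eb eqxx in nb.
move=> /IH h /h [i' [lt et ed]]; exists i'.+1; split=> //.
by rewrite et /= psi_cons /block (negPf nb).
Qed.

Lemma psi_sorted a w c :
  sorted (fun b c => (b == a) || (c == a)) (rcons (rcons (psi a w) a) c).
Proof.
set e := (fun _ => _); have hs : sorted e (rcons (psi a w) a).
  elim: w => [|b w] //; rewrite psi_cons rcons_cat.
  have [u ->] := psi_head a w.
  by rewrite /block; case: eqP => _ /= hu; rewrite /e /= eqxx ?orbT.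
have [u eu] := psi_head a w; move: (hs); rewrite eu /= rcons_path => ->.
have -> : last a u = last a (rcons (psi a w) a) by rewrite eu.
by rewrite last_rcons /e eqxx.
Qed.

(** Cutting from the left: the relation puts an [a] before each other letter, and the two form a
    block; the final [a] is left over. *)
Lemma psi_surj a q : last a q = a -> head a q = a -> q != [::] ->
  sorted (fun b c => (b == a) || (c == a)) q -> exists w, q = rcons (psi a w) a.
Proof.
move=> h1 h2 h3 h4.
have [m] := ubnP (size q); elim: m q h1 h2 h3 h4 => // m IH.
case=> [|b q] // h1 /= hb _; rewrite hb in h1 * => {b hb}.
case: q h1 => [|b q] /= h1 hs hm; first by exists [::].
case: (eqVneq b a) hs => [eb|nb] /= hs.
  case/andP: hs => _ hs; have [w ew] := IH (b :: q) h1 eb isT hs hm.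
  by exists (a :: w); rewrite psi_cons /block eqxx /= -ew eb.
case: q h1 hs hm => [|c q] /= h1 hs hm; first by rewrite h1 eqxx in nb.
case/and3P: hs => _; rewrite (negPf nb) /= => /eqP ec hs.
have [w ew] := IH (c :: q) h1 ec isT hs (ltnW hm).
by exists (b :: w); rewrite psi_cons /block (negPf nb) /= -ew.
Qed.

(** The letter after the [a] that opens a block is always the letter coded by that block, even when
    it is [a], since the next block or the appended [a] begins with [a]. Hence [c] can be read
    off. *)
Lemma prefix_psi a w c q :
  prefix (rcons (rcons (psi a w) a) c) (rcons (psi a q) a) = prefix (rcons w c) q.
Proof.
elim: w q => [|b w IH] [|b' q].
- by rewrite /= /psi /= eqxx.
- rewrite psi_cons /=; have [u eu] := psi_head a q.
  rewrite /block; case: (eqVneq b' a) => [->|nb] /=; rewrite eqxx /=.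
    by rewrite eu /= !prefix0s.
  by rewrite !prefix0s.
- by apply/negbTE/negP => /size_prefix; rewrite !size_rcons.
rewrite !psi_cons /=; have [u eu] := psi_head a q.
have [u' eu'] := psi_head a w.
rewrite /block; case: (boolP (b == a)) => [/eqP ->|nb];
  case: (boolP (b' == a)) => [/eqP ->|nb'] /=; rewrite ?eqxx ?IH //=.
- by rewrite eu' /= [a == b']eq_sym (negPf nb').
- by rewrite eu /= (negPf nb).
Qed.

Lemma pal_tail u y : palindrome (u ++ y) -> size y <= size u ->
  y = rev (take (size y) u).
Proof.
rewrite /palindrome rev_cat => e h.
have /(congr1 rev) := congr1 (take (size y)) e.
by rewrite take_size_cat ?size_rev // revK takel_cat.
Qed.

Lemma pal_closure_size w p : is_pal_closure w p -> size p <= (size w).*2.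
Proof.
move=> [_ _ /(_ (w ++ rev w))]; rewrite size_cat size_rev addnn; apply.
  by rewrite /palindrome rev_cat revK.
exact: prefix_prefix.
Qed.

Lemma pal_closure_rcons_size w c p :
  is_pal_closure (rcons w c) p -> size p <= (size w).*2.+1.
Proof.
move=> [_ _ /(_ (rcons w c ++ rev w))].
rewrite size_cat size_rev size_rcons addSn addnn; apply.
  by rewrite /palindrome rev_cat revK rev_rcons -cats1 -catA.
exact: prefix_prefix.
Qed.

Lemma pal_closure_uniq w p q : is_pal_closure w p -> is_pal_closure w q -> p = q.
Proof.
move=> hp hq; have [lp lq] := (pal_closure_size hp, pal_closure_size hq).
case: hp hq => pp wp mp [pq wq mq].
have e : size p = size q by apply/eqP; rewrite eqn_leq mp // mq.
case/prefix_cat: wp => y ep; case/prefix_cat: wq => z eq; subst.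
move: lp lq e; rewrite !size_cat => lp lq e.
have ey : size y = size z by apply: (@addnI (size w)).
have ly : size y <= size w by move: lp; rewrite -addnn leq_add2l.
have ty := pal_tail pp ly; have tz := pal_tail pq; rewrite -ey in tz.
by rewrite ty tz.
Qed.

(* The letters of p after [rcons w c] are forced by symmetry, so a palindrome
   with this prefix has psi-length at least that of p as soon as it is not
   shorter than p. *)
Lemma pal_closure_psi a w c p : is_pal_closure (rcons w c) p ->
  is_pal_closure (rcons (rcons (psi a w) a) c) (rcons (psi a p) a).
Proof.
move=> hp; have := pal_closure_rcons_size hp.
case: hp => pp wp mp sp; split.
- by rewrite /palindrome -psi_rev pp.
- by rewrite prefix_psi.
move=> q pq wq; case/prefix_cat: (wp) => y ep.
have ly : size y <= size w by move: sp; rewrite ep size_cat size_rcons; lia.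
have tail z : palindrome (rcons w c ++ z) -> size y <= size z ->
    exists u, z = u ++ rev (take (size y) w).
  rewrite /palindrome rev_cat => e lz; exists (rev (drop (size y) (rev z))).
  have <- : take (size y) (rev z) = take (size y) w.
    have := congr1 (take (size y)) e; rewrite takel_cat ?size_rev // => ->.
    rewrite takel_cat ?size_rcons ?(leq_trans ly) // -cats1 takel_cat //.
  by rewrite -rev_cat cat_take_drop revK.
have sy : size (psi a y) = size (psi a (take (size y) w)).
  have [|u eu] := tail y _ (leqnn _); first by rewrite -ep.
  have := congr1 size eu; rewrite size_cat size_rev size_takel // => su.
  have u0 : u = [::] by case: u su {eu} => //= b u; lia.
  by rewrite {1}eu u0 size_psi_rev.
have ltw : size (psi a (take (size y) w)) <= size (psi a w).
  by rewrite -{2}(cat_take_drop (size y) w) psi_cat size_cat leq_addr.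
have blk : size (block a c) <= 2 by rewrite /block; case: eqP.
rewrite size_rcons ep -cats1 !psi_cat !size_cat sy.
(* Beyond this length nothing remains to be shown: the images of [w], [c], [y] and the final [a]
   take at most that many letters. *)
have [lq|lq] := leqP (size (psi a w)).*2.+3 (size q) => /=; first lia.
have sq : (size (psi a w)).+1 < size q.
  by have := size_prefix wq; rewrite !size_rcons.
case/prefix_cat: (wq) => z eq; have [v ev] := psi_head a w.
(* A shorter [q] can be desubstituted: its known prefix covers more than half of it, and reflection
   carries the adjacency condition of [psi_surj] to the rest. *)
have [q' eq'] : exists q', q = rcons (psi a q') a.
  have q0 : 0 < size q by lia.
  apply: psi_surj.
  - by rewrite -nth_last -[q in nth _ q]pq nth_rev ?prednK // subnn eq ev.
  - by rewrite eq ev.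
  - by rewrite -size_eq0 -lt0n.
  have nq i : i <= (size (psi a w)).+1 ->
      nth a q i = nth a (rcons (rcons (psi a w) a) c) i.
    by move=> hi; rewrite eq nth_cat !size_rcons ltnS hi.
  have adj i : i < (size (psi a w)).+1 -> (nth a q i == a) || (nth a q i.+1 == a).
    move=> hi; rewrite !nq //; last lia.
    by have /(sortedP a) := psi_sorted a w c; apply; rewrite !size_rcons; lia.
  apply/(sortedP a) => i hi.
  have [li|li] := ltnP i (size (psi a w)).+1; first exact: adj.
  have nr m : m < size q -> nth a q m = nth a q (size q - m.+1).
    by move=> hm; rewrite -{1}pq nth_rev.
  rewrite orbC (nr i) // ?(nr i.+1) //; last lia.
  have := adj (size q - i.+2); rewrite (_ : (size q - i.+2).+1 = size q - i.+1); first by apply; lia.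
  lia.
have pq' : palindrome q'.
  by move: pq; rewrite eq' /palindrome -psi_rev => /rcons_inj[] /psi_inj.
have wq' : prefix (rcons w c) q' by move: wq; rewrite eq' prefix_psi.
have := mp _ pq' wq'; case/prefix_cat: (wq') => z' ez'.
rewrite ep ez' !size_cat leq_add2l => lz.
have [|u eu] := tail z' _ lz; first by rewrite -ez'.
rewrite eq' ez' size_rcons eu -cats1 !psi_cat !size_cat size_psi_rev; lia.
Qed.
End Psi.

(** * Justin's formula and the desubstitution of tails *)

Section Directive.
Variables (A : finType) (x : nat -> A).
Implicit Types (a b c : A) (w u : seq A) (i j l n p : nat).

(* Justin's formula: Pal j n is the palindromic prefix u_(n+1) of the standard
   episturmian word with directive word x_j x_(j+1) ... *)
Fixpoint Pal j n : seq A :=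
  if n is n'.+1 then rcons (psi (x j) (Pal j.+1 n')) (x j) else [::].

Lemma Pal_closure j n : is_pal_closure (rcons (Pal j n) (x (j + n))) (Pal j n.+1).
Proof.
elim: n j => [|n IH] j; last by rewrite -addSnnS; exact: pal_closure_psi.
rewrite addn0; split=> //=; last by move=> q _ /size_prefix.
by rewrite eqxx.
Qed.

Lemma Pal_prefix j n : prefix (Pal j n) (Pal j n.+1).
Proof.
have [_ + _] := Pal_closure j n; apply: prefix_trans.
exact: prefix_rcons.
Qed.

Lemma Pal_prefix_leq j n m : n <= m -> prefix (Pal j n) (Pal j m).
Proof.
move=> /subnK <-; elim: (m - n) => [|i IH]; first exact: prefix_refl.
exact: prefix_trans IH (Pal_prefix _ _).
Qed.

Lemma size_Pal j n : n <= size (Pal j n).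
Proof.
elim: n j => //= n IH j; rewrite size_rcons ltnS.
exact: leq_trans (IH _) (leq_size_psi _ _).
Qed.

(* The standard episturmian word with directive word x_j x_(j+1) ... *)
Definition tail j : nat -> A := fun i => nth (x j) (Pal j i.+1) i.

Lemma nth_Pal j n i : i < size (Pal j n) -> nth (x j) (Pal j n) i = tail j i.
Proof.
move=> hi; rewrite /tail; have hi' := size_Pal j i.+1.
have [le|/ltnW le] := leqP n i.+1; have /prefixP[y ->] := Pal_prefix_leq j le.
  by rewrite nth_cat hi.
by rewrite nth_cat hi'.
Qed.

Lemma mkseq_tail j n : mkseq (tail j) (size (Pal j n)) = Pal j n.
Proof.
apply: (@eq_from_nth _ (x j)); rewrite size_mkseq // => i hi.
by rewrite nth_mkseq // nth_Pal.
Qed.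

Lemma standard_episturmian_tail s : standard_episturmian x s -> s =1 tail 0.
Proof.
case=> u [u0 uS lim] i.
have {uS u0} eu n : u n = Pal 0 n.
  elim: n => [|n IH]; first by rewrite u0.
  by apply: pal_closure_uniq (uS n) _; rewrite IH -[n in x n]add0n; exact: Pal_closure.
have [N /(_ N (leqnn N))] := lim i; rewrite eu => -[hi <-].
by rewrite -(nth_Pal hi); exact: set_nth_default.
Qed.

(** The start, in [tail j], of the block coding letter [p] of [tail j.+1]. *)
Definition bpos j p := size (psi (x j) (mkseq (tail j.+1) p)).

Lemma mkseq_leq (t : nat -> A) n m : n <= m -> mkseq t n = take n (mkseq t m).
Proof. by move=> h; rewrite /mkseq -map_take take_iota (minn_idPl h). Qed.

(** On prefixes, this is the identity between [tail j] and the image of [tail j.+1] under psi_(x_j);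
    the extra letter opens the next block. *)
Lemma mkseq_bposS j p : mkseq (tail j) (bpos j p).+1 =
  rcons (psi (x j) (mkseq (tail j.+1) p)) (x j).
Proof.
have hp := size_Pal j.+1 p.
have e : prefix (rcons (psi (x j) (mkseq (tail j.+1) p)) (x j)) (Pal j p.+1).
  rewrite /= -(mkseq_tail j.+1 p) (mkseq_leq _ hp).
  set w := mkseq _ _; rewrite -{2}(cat_take_drop p w) psi_cat rcons_cat.
  by have [u ->] := psi_head (x j) (drop p w); rewrite -cat_rcons prefix_prefix.
have := size_prefix e; rewrite size_rcons => le.
case/prefixP: e => y; rewrite -mkseq_tail => /(congr1 (take (bpos j p).+1)).
rewrite [RHS]take_size_cat; last by rewrite size_rcons.
move=> <-.
exact: mkseq_leq.
Qed.

Lemma mkseq_bpos j p : mkseq (tail j) (bpos j p) = psi (x j) (mkseq (tail j.+1) p).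
Proof.
rewrite (mkseq_leq _ (leqnSn _)) mkseq_bposS -cats1 take_cat.
by rewrite ltnn subnn cats0.
Qed.

Lemma tail_bpos j p : tail j (bpos j p) = x j.
Proof.
have := congr1 (fun w => nth (x j) w (bpos j p)) (mkseq_bposS j p).
by rewrite nth_mkseq // nth_rcons ltnn eqxx.
Qed.

Lemma tail0 j : tail j 0 = x j. Proof. exact: (tail_bpos j 0). Qed.

Lemma bposS j p : bpos j p.+1 = bpos j p + (tail j.+1 p != x j).+1.
Proof.
rewrite /bpos mkseqS -cats1 psi_cat size_cat; congr addn.
by rewrite /psi /= cats0 /block; case: eqP.
Qed.

Lemma tail_bposS j p : tail j (bpos j p).+1 = tail j.+1 p.
Proof.
have [e|ne] := eqVneq (tail j.+1 p) (x j).
  by have := tail_bpos j p.+1; rewrite bposS e eqxx addn1.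
have := congr1 (fun w => nth (x j) w (bpos j p).+1) (mkseq_bposS j p.+1).
rewrite nth_mkseq ?bposS ?ne ?addn2 // => ->.
rewrite mkseqS -(cats1 (mkseq _ _)) psi_cat rcons_cat nth_cat ltnNge leqnSn /= subSnn.
by rewrite /psi /= /block (negPf ne).
Qed.

Lemma bpos_mono j : {mono bpos j : p q / p < q}.
Proof.
apply: leqW_mono; apply: leq_mono; apply: homo_ltn; first exact: ltn_trans.
by move=> p; rewrite bposS; lia.
Qed.

Lemma bpos_leq j p : p <= bpos j p.
Proof. by rewrite -{1}(size_mkseq (tail j.+1) p) leq_size_psi. Qed.

(** A block contains [x j] only as its opening letter, so positions desubstitute without
    ambiguity. *)
Lemma tail_eq_bpos j i : tail j i = x j -> exists p, i = bpos j p.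
Proof.
move=> e; have hi := bpos_leq j i.+1.
have h2 : nth (x j) (psi (x j) (mkseq (tail j.+1) i.+1)) i = x j.
  by rewrite -mkseq_bpos nth_mkseq.
have [p [hp + _]] := psi_split hi h2.
rewrite size_mkseq in hp; rewrite -mkseq_leq 1?ltnW // => /(congr1 size).
by rewrite size_takel 1?ltnW // => ->; exists p.
Qed.

Lemma tail_neq_bpos j i : tail j i != x j ->
  exists2 p, i = (bpos j p).+1 & tail j.+1 p = tail j i.
Proof.
have [p hp] : exists2 p, bpos j p <= i & i < bpos j p.+1.
  elim: i => [|i [p h1 h2]]; first by exists 0; rewrite ?bposS.
  have [h|h] := ltnP i.+1 (bpos j p.+1); first by exists p => //; exact: leqW.
  by exists p.+1 => //; rewrite (@leq_ltn_trans (bpos j p.+1)) ?bpos_mono.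
rewrite bposS => hi ne.
have [e|] := eqVneq i (bpos j p); first by rewrite e tail_bpos eqxx in ne.
move=> nei; have e : i = (bpos j p).+1 by move: hi; case: (_ != _) => /=; lia.
by exists p => //; rewrite e tail_bposS.
Qed.

End Directive.

(** * Repeated factors and their windows *)

Section Squares.
Variables (A : finType) (x : nat -> A).
Implicit Types (a b c : A) (w u : seq A) (i j l n p q m : nat).

Local Notation T := (tail x).

Fixpoint Psi j w : seq A := if j is j'.+1 then Psi j' (psi (x j') w) else w.

(* pal j is [Pal 0 j], written with the recurrence u_(j+1) = Psi_j(x_j) u_j. *)
Fixpoint pal j : seq A := if j is j'.+1 then Psi j' [:: x j'] ++ pal j' else [::].

Definition lenPsi j b := size (Psi j [:: b]).

(** The block boundaries of level [j]: where the image under Psi_j of letter [p] of [tail j] starts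
    in [tail 0]. *)
Definition pos j p := size (Psi j (mkseq (T j) p)).

Lemma Psi_cat j u w : Psi j (u ++ w) = Psi j u ++ Psi j w.
Proof. by elim: j u w => //= j IH u w; rewrite psi_cat IH. Qed.

Lemma PsiS j b : Psi j.+1 [:: b] =
  if b == x j then Psi j [:: x j] else Psi j [:: x j] ++ Psi j [:: b].
Proof. by rewrite /= /psi /= /block; case: eqP => //= _; rewrite -Psi_cat. Qed.

Lemma lenPsiS j b : lenPsi j.+1 b = if b == x j then lenPsi j (x j) else lenPsi j (x j) + lenPsi j b.
Proof. by rewrite /lenPsi PsiS; case: ifP; rewrite // size_cat. Qed.

Lemma size_palS j : size (pal j.+1) = lenPsi j (x j) + size (pal j).
Proof. by rewrite /= size_cat. Qed.

Lemma leq_size_Psi j w : size w <= size (Psi j w).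
Proof.
elim: j w => //= j IH w; exact: leq_trans (leq_size_psi _ _) (IH _).
Qed.

Lemma lenPsi_gt0 j b : 0 < lenPsi j b. Proof. exact: (leq_size_Psi j [:: b]). Qed.

(* This forces a factor f of [tail j] with |Psi_j(f)| <= |pal j| to be a power of
   a single letter. *)
Lemma size_pal_lt_lenPsi2 j b c : b != c -> size (pal j) < lenPsi j b + lenPsi j c.
Proof.
move=> nbc; elim: j => [|j IH] //; rewrite size_palS !lenPsiS.
case: (eqVneq b (x j)) nbc IH => [->|_]; case: (eqVneq c (x j)) => [->|_] //=.
- by move=> _; lia.
- by move=> _; lia.
- by move=> _; have := lenPsi_gt0 j (x j); lia.
Qed.

Lemma pos0 p : pos 0 p = p. Proof. exact: size_mkseq. Qed.

Lemma posS j p : pos j p.+1 = pos j p + lenPsi j (T j p).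
Proof. by rewrite /pos mkseqS -cats1 Psi_cat size_cat. Qed.

Lemma pos_bpos j p : pos j (bpos x j p) = pos j.+1 p.
Proof. by rewrite /pos mkseq_bpos. Qed.

Lemma pos_mono j : {mono pos j : p q / p <= q}.
Proof.
apply: leq_mono; apply: homo_ltn; first exact: ltn_trans.
by move=> p; rewrite posS; have := lenPsi_gt0 j (T j p); lia.
Qed.

Definition agree j p q l := forall t, t < l -> T j (p + t) = T j (q + t).

Lemma agreeS j p q l : T j p = T j q -> agree j p.+1 q.+1 l -> agree j p q l.+1.
Proof.
by move=> e ag [|t] ht; rewrite ?addn0 // -!addSnnS ag.
Qed.

(** Common blocks are peeled off one at a time, each identified by the letter after its opening one.
    At most one letter is left over, the [x j] opening the next block, which carries no
    information. *)
Lemma agree_bpos l j p q : 0 < l -> agree j (bpos x j p) (bpos x j q) l ->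
  exists l', [/\ l' < l, agree j.+1 p q l'
               & bpos x j p + l <= (bpos x j (p + l')).+1].
Proof.
have [N] := ubnP l; elim: N l p q => // N IH [|[|l]] // p q hl _ ag.
  by exists 0; split=> //; rewrite addn0 addn1.
have e : T j.+1 p = T j.+1 q.
  by have := ag 1 isT; rewrite !addn1 !tail_bposS.
have [ep eq] := (bposS x j p, bposS x j q); rewrite -e in eq.
set d := (tail x j.+1 p != x j) in ep eq.
have [ld|ld] := ltnP l d.
  exists 1; split=> //; last by rewrite addn1 ep; case: (d) ld => /=; lia.
  by case=> // _; rewrite !addn0.
have [|||l' [lt ag' le]] := IH (l.+1 - d) p.+1 q.+1; try (case: (d) ld => /=; lia).
  move=> t ht; rewrite ep eq -!addnA; apply: ag.
  by case: (d) ld ht => /=; lia.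
exists l'.+1; split.
- by case: (d) ld lt => /=; lia.
- exact: agreeS.
by move: le; rewrite ep addSnnS; case: (d) ld => /=; lia.
Qed.

(* The occurrences of a factor of length l at positions p and q of [tail j] lie,
   after Psi_j, at the same offset c in two occurrences of [pal j'] that start at
   block boundaries of level j'. *)
Definition in_window j p q l j' p' q' := exists c : nat,
  [/\ p' < q', pos j p = pos j' p' + c, pos j q = pos j' q' + c
    & pos j (p + l) + size (pal j) <= pos j' p' + size (pal j')].

Hypothesis recurrent : forall b j, exists n, x (j + n) = b.

(** A single letter other than [x j] stays a single letter when desubstituted, so the induction is
    on the number of levels until the directive word uses it. *)
Lemma letter_window j p q : p < q -> T j p = T j q ->
  exists j' p' q', in_window j p q 1 j' p' q'.
Proof.
have [n] := recurrent (T j p) j; elim: n j p q => [|n IH] j p q en lpq e.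
  rewrite addn0 in en; move: (esym en); rewrite {1}e => /tail_eq_bpos[q' eq].
  case: (tail_eq_bpos (esym en)) => p' ep.
  exists j.+1, p', q', 0; rewrite !addn0 -!pos_bpos -ep -eq; split=> //.
    by rewrite -(bpos_mono x j) -ep -eq.
  by rewrite size_palS addn1 posS -en addnA.
have [ea|na] := eqVneq (T j p) (x j).
  move: (ea); rewrite {1}e => /tail_eq_bpos[q' eq].
  case: (tail_eq_bpos ea) => p' ep.
  exists j.+1, p', q', 0; rewrite !addn0 -!pos_bpos -ep -eq; split=> //.
    by rewrite -(bpos_mono x j) -ep -eq.
  by rewrite size_palS addn1 posS ea addnA.
have [p' ep e1] := tail_neq_bpos na.
move: (na); rewrite {1}e => /tail_neq_bpos[q' eq e2].
have l' : p' < q' by rewrite -(bpos_mono x j); lia.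
have en' : x (j.+1 + n) = T j.+1 p' by rewrite addSnnS en e1.
have [|j' [p2 [q2 [c [l2 ep2 eq2 le]]]]] := IH j.+1 p' q' en' l'.
  by rewrite e1 e2.
(* The occurrence starts after the opening [x j] of its block, hence the additional offset. *)
exists j', p2, q2, (c + lenPsi j (x j)); split=> //.
- by rewrite ep posS tail_bpos pos_bpos ep2 addnA.
- by rewrite eq posS tail_bpos pos_bpos eq2 addnA.
apply: leq_trans le; rewrite !addn1 size_palS -pos_bpos bposS e1 na ep addn2; lia.
Qed.

(** Desubstitution strictly shortens an agreement, except possibly one of length 1, which
    [letter_window] handles. *)
Lemma repeat_window l j p q : p < q -> agree j p q l ->
  exists j' p' q', in_window j p q l j' p' q'.
Proof.
have [N] := ubnP l; elim: N l j p q => // N IH [|l] j p q hl lpq ag.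
  by exists j, p, q, 0; rewrite !addn0.
have e : T j p = T j q by have := ag 0 isT; rewrite !addn0.
have [ea|na] := eqVneq (T j p) (x j).
  move: (ea); rewrite {1}e => /tail_eq_bpos[q' eq].
  case: (tail_eq_bpos ea) => p' ep; subst.
  have [l' [ll ag' le]] := @agree_bpos l.+1 j p' q' isT ag.
  have lpq' : p' < q' by rewrite -(bpos_mono x j).
  have [|j' [p2 [q2 [c [l2 ep2 eq2 le2]]]]] := IH l' j.+1 p' q' _ lpq' ag'; first lia.
  exists j', p2, q2, c; rewrite !pos_bpos; split=> //.
  apply: leq_trans le2; rewrite size_palS addnA leq_add2r.
  by rewrite -pos_bpos -[X in lenPsi _ X](tail_bpos x j (p' + l')) -posS pos_mono.
case: l hl ag => [|l] hl ag; first exact: letter_window.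
have [p' ep e1] := tail_neq_bpos na.
move: (na); rewrite {1}e => /tail_neq_bpos[q' eq e2].
have lpq' : p' < q' by rewrite -(bpos_mono x j); lia.
have bp : bpos x j p'.+1 = p.+1 by rewrite bposS e1 na addn2 ep.
have bq : bpos x j q'.+1 = q.+1 by rewrite bposS e2 -e na addn2 eq.
have [|l' [ll ag' le]] := @agree_bpos l.+1 j p'.+1 q'.+1 isT.
  by rewrite bp bq => t ht; rewrite !addSnnS ag.
have ag2 : agree j.+1 p' q' l'.+1 by apply: agreeS => //; rewrite e1 e2.
have [|j' [p2 [q2 [c [l2 ep2 eq2 le2]]]]] := IH l'.+1 j.+1 p' q' _ lpq' ag2; first lia.
exists j', p2, q2, (c + lenPsi j (x j)); split=> //.
- by rewrite ep posS tail_bpos pos_bpos ep2 addnA.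
- by rewrite eq posS tail_bpos pos_bpos eq2 addnA.
apply: leq_trans le2; rewrite size_palS addnA leq_add2r.
rewrite -pos_bpos -[X in lenPsi _ X](tail_bpos x j (p' + l'.+1)) -posS pos_mono.
by move: le; rewrite bp -(addSnnS p' l'); lia.
Qed.

(** The next block opens with [x j], and its image followed by [pal j] is [pal j.+1]; so a
    palindromic prefix starts at each boundary. *)
Lemma mkseq_pal j p :
  mkseq (T 0) (pos j p + size (pal j)) = Psi j (mkseq (T j) p) ++ pal j.
Proof.
elim: j p => [|j IH] p; first by rewrite /= addn0 cats0 pos0.
rewrite size_palS addnA -pos_bpos -[X in lenPsi _ X](tail_bpos x j p) -posS IH.
by rewrite mkseq_bposS -cats1 Psi_cat /= catA.
Qed.

End Squares.

(** * Powers of words and their rotations *)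

Section Wpow.
Variable A : finType.
Implicit Types (w u : seq A) (l i t : nat).

Lemma wpowS w l : wpow w l.+1 = w ++ wpow w l. Proof. by []. Qed.

Lemma wpow1 w : wpow w 1 = w. Proof. exact: cats0. Qed.

Lemma size_wpow w l : size (wpow w l) = l * size w.
Proof. by elim: l => //= l IH; rewrite wpowS size_cat IH mulSn. Qed.

Lemma nth_wpow b w l t : t < l * size w ->
  nth b (wpow w l) t = nth b w (t %% size w).
Proof.
elim: l t => // l IH t; rewrite wpowS nth_cat mulSn => ht.
case: ltnP => [lt|ge]; first by rewrite modn_small.
by rewrite IH; [rewrite -{2}(subnKC ge) modnDl | lia].
Qed.

Lemma nth_rot b w i t : i <= size w -> t < size w ->
  nth b (rot i w) t = nth b w ((i + t) %% size w).
Proof.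
move=> hi ht; rewrite /rot nth_cat size_drop nth_drop.
case: ltnP => lt; first by rewrite modn_small //; lia.
rewrite nth_take; last lia.
have -> : i + t = t - (size w - i) + size w by lia.
by rewrite modnDr modn_small //; lia.
Qed.

Lemma nth_rot_wpow b w l i t : i <= size w -> 0 < l -> t < l * size w ->
  nth b (rot i (wpow w l)) t = nth b w ((i + t) %% size w).
Proof.
move=> hi l0 ht; have w0 : 0 < size w by case: (size w) ht; rewrite ?muln0.
have sw : size w <= l * size w by rewrite leq_pmull.
rewrite nth_rot ?size_wpow //; last exact: leq_trans sw.
rewrite nth_wpow; last by rewrite ltn_mod; lia.
by rewrite modn_dvdm // dvdn_mull.
Qed.

Lemma rot_wpow w l i : i <= size w -> rot i (wpow w l) = wpow (rot i w) l.
Proof.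
case: l => [|l] hi; first by case: i hi.
have [w0|w0] := posnP (size w).
  by rewrite (size0nil w0) /rot; elim: (l) => //.
have [b _] : exists b : A, True by case: (w) w0 => // b; exists b.
apply: (@eq_from_nth _ b) => [|t]; rewrite !(size_rot, size_wpow) // => ht.
rewrite nth_rot_wpow // nth_wpow size_rot // nth_rot ?ltn_mod //.
by rewrite modnDmr.
Qed.

End Wpow.

(** * Squares as windows on runs of one letter *)

Section SquareStructure.
Variables (A : finType) (x : nat -> A).
Implicit Types (a b c : A) (w u : seq A) (i j l n p q m : nat).

Local Notation T := (tail x).
Local Notation Psi := (Psi x).
Local Notation pal := (pal x).
Local Notation lenPsi := (lenPsi x).

Definition run j p b l := forall t, t < l -> T j (p + t) = b.

Lemma mkseq_run j p b l : run j p b l ->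
  mkseq (T j) (p + l) = mkseq (T j) p ++ nseq l b.
Proof.
elim: l => [|l IH] r; first by rewrite addn0 cats0.
rewrite addnS mkseqS IH; last by move=> t ht; apply: r; exact: leqW.
by rewrite r // rcons_cat -cats1 -(nseqD l 1) addn1.
Qed.

Lemma Psi_nseq j b l : Psi j (nseq l b) = wpow (Psi j [:: b]) l.
Proof.
by elim: l => [|l IH]; [elim: j | rewrite wpowS -IH -Psi_cat].
Qed.

(** The word [pal j] follows the [l] images and also starts at [pos x j p], so a letter beyond the
    images repeats the one [l * lenPsi j b] places earlier. *)
Lemma tail_window j p b l t : run j p b l -> 0 < l -> t < l * lenPsi j b + size (pal j) ->
  T 0 (pos x j p + t) = nth b (Psi j [:: b]) (t %% lenPsi j b).
Proof.
move=> r l0.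
have win q t' : t' < pos x j q + size (pal j) ->
    T 0 t' = nth b (Psi j (mkseq (T j) q) ++ pal j) t'.
  by move=> ht; rewrite -mkseq_pal nth_mkseq.
have winl t' : t' < l * lenPsi j b + size (pal j) ->
    T 0 (pos x j p + t') = nth b (wpow (Psi j [:: b]) l ++ pal j) t'.
  have ep : pos x j (p + l) = pos x j p + l * lenPsi j b.
    by rewrite /pos (mkseq_run r) Psi_cat size_cat Psi_nseq size_wpow.
  move=> ht; rewrite (win (p + l)) ?ep -?addnA ?ltn_add2l // (mkseq_run r) Psi_cat Psi_nseq -catA.
  by rewrite nth_cat -/(pos x j p) ltnNge leq_addr /= addKn.
have h0 := lenPsi_gt0 x j b.
have [N] := ubnP t; elim: N t => // N IH t htN ht.
rewrite winl // nth_cat size_wpow -/(lenPsi j b); case: ltnP => le; first exact: nth_wpow.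
have -> : nth b (pal j) (t - l * lenPsi j b) = T 0 (pos x j p + (t - l * lenPsi j b)).
  rewrite (win p); last lia.
  by rewrite nth_cat -/(pos x j p) ltnNge leq_addr /= addKn.
have lh : 0 < l * lenPsi j b by rewrite muln_gt0 l0.
rewrite IH; try lia.
by rewrite -{2}(subnKC le) modnMDl.
Qed.

Lemma square_intro j p b l i : run j p b l -> 0 < l -> i + l * lenPsi j b <= size (pal j) ->
  Ppow (T 0) (l * lenPsi j b) 2 (rot (i %% lenPsi j b) (wpow (Psi j [:: b]) l)).
Proof.
move=> r l0 hi; have h0 := lenPsi_gt0 x j b.
set w := rot _ _; have sw : size w = l * lenPsi j b by rewrite size_rot size_wpow.
have hi' : i %% lenPsi j b <= lenPsi j b by rewrite ltnW // ltn_mod.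
split=> //; exists (pos x j p + i).
apply: (@eq_from_nth _ b); rewrite ?size_mkseq // size_wpow => t ht.
rewrite nth_wpow // nth_mkseq ?size_wpow // sw.
rewrite nth_rot_wpow ?ltn_mod ?muln_gt0 ?l0 // -/(lenPsi j b).
rewrite -addnA (tail_window r) //; last by move: ht; rewrite sw; lia.
by rewrite modnDml -modnDmr modn_dvdm ?dvdn_mull // modnDmr.
Qed.

Hypothesis recurrent : forall b j, exists n, x (j + n) = b.

(** A square is an agreement of length [m] between positions at distance [m]; its window has two
    boundaries at that distance. *)
Lemma square_elim m w : 0 < m -> Ppow (T 0) m 2 w ->
  exists j p b l i, [/\ run j p b l, 0 < l, m = l * lenPsi j b, i + m <= size (pal j)
    & w = rot (i %% lenPsi j b) (wpow (Psi j [:: b]) l)].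
Proof.
move=> m0 [sw [i0 e]].
have [b0 _] : exists b : A, True by case: (w) sw m0 => [|b]; [case: m {e} => // | exists b].
have nw t : t < m -> nth b0 w t = T 0 (i0 + t) /\ nth b0 w t = T 0 (i0 + m + t).
  move=> ht; have n2 t' : t' < 2 * m -> nth b0 w (t' %% m) = T 0 (i0 + t').
    by move=> ht'; rewrite -sw -(@nth_wpow _ _ _ 2) ?sw // e nth_mkseq // size_wpow sw.
  rewrite -n2; last lia.
  rewrite -addnA -n2; last lia.
  by rewrite modnDl modn_small.
have ag : agree x 0 i0 (i0 + m) m by move=> t /nw[<- <-].
have [|j [p [q [c [lpq e1 e2 le]]]]] := repeat_window recurrent _ ag; first lia.
rewrite !pos0 addn0 in e1 e2 le.
have mono := pos_mono x j.
(* A second letter between the boundaries would make [m] at least the sum of two image lengths, more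
   than [size (pal j)]. *)
have r : run j p (T j p) (q - p).
  move=> t ht; apply/eqP/negPn/negP; rewrite eq_sym => ne.
  have := size_pal_lt_lenPsi2 x j ne.
  case: t ht ne => [|t] ht ne; first by rewrite addn0 eqxx in ne.
  have : pos x j p.+1 <= pos x j (p + t.+1) by rewrite mono; lia.
  have : pos x j (p + t.+1).+1 <= pos x j q by rewrite mono; lia.
  rewrite !posS; lia.
have em : m = (q - p) * lenPsi j (T j p).
  have : pos x j q = pos x j p + m by lia.
  rewrite -{1}(subnKC (ltnW lpq)) {1}/pos (mkseq_run r) Psi_cat size_cat Psi_nseq.
  by rewrite size_wpow => /addnI ->.
exists j, p, (T j p), (q - p), c; split=> //; try lia.
have h0 := lenPsi_gt0 x j (T j p).
apply: (@eq_from_nth _ b0); first by rewrite size_rot size_wpow sw em.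
move=> t; rewrite sw => ht; have [-> _] := nw t ht.
rewrite (set_nth_default (T j p)); last by rewrite size_rot size_wpow -em.
rewrite nth_rot_wpow -?em ?subn_gt0 //; last by rewrite ltnW // ltn_mod.
by rewrite modnDml -(tail_window r) ?subn_gt0 // -?em; [congr T|]; lia.
Qed.

End SquareStructure.

(** * Primitivity of the images of letters *)

Section Primitive.
Variables (A : finType) (x : nat -> A).
Implicit Types (a b c : A) (w u : seq A).

Definition primitive w := forall i, 0 < i < size w -> rot i w <> w.

(** A rotation fixing [psi a w] must cut before an [a], hence between blocks, and so comes from a
    rotation fixing [w]. *)
Lemma primitive_psi a w : primitive w -> primitive (psi a w).
Proof.
move=> pw i /andP[i0 hi] e.
have ha : nth a (psi a w) i = a.
  rewrite -[i in LHS]addn0 -nth_drop.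
  have -> : nth a (drop i (psi a w)) 0 = nth a (rot i (psi a w)) 0.
    by rewrite /rot nth_cat size_drop subn_gt0 hi.
  by rewrite e; case: (w) => // b u; rewrite psi_cons /block; case: eqP.
have [i' [hi' et ed]] := psi_split hi ha.
apply: (pw i'); last first.
  by apply: (@psi_inj _ a); rewrite /rot psi_cat -et -ed.
rewrite hi' andbT lt0n; apply/eqP => z; move: (congr1 size et).
by rewrite z take0 (size_takel (ltnW hi)) => ei; rewrite ei in i0.
Qed.

Lemma primitive_Psi j b : primitive (Psi x j [:: b]).
Proof.
suff: forall w, primitive w -> primitive (Psi x j w) by apply; case.
by elim: j => //= j IH w pw; apply: IH; exact: primitive_psi.
Qed.

Lemma primitive_rot_inj w i j : primitive w -> i < size w -> j < size w ->
  rot i w = rot j w -> i = j.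
Proof.
move=> pw; wlog lij : i j / i <= j => [hw|] hi hj e.
  by have [/hw|/ltnW/hw] := leqP i j; [|move=> H; apply/esym]; auto.
apply/eqP; rewrite eqn_leq lij /=; rewrite leqNgt; apply/negP => lt.
apply: (pw (j - i)); first lia.
apply: (@rot_inj i); rewrite e.
by rewrite -rotD subnKC // ltnW.
Qed.

End Primitive.

(** * Lengths of runs under desubstitution *)

Section Runs.
Variables (A : finType) (x : nat -> A).
Implicit Types (b : A) (j l n p : nat).
Local Notation T := (tail x).

Lemma run_neq j p b l : run x j p b l -> b != x j -> l <= 1.
Proof.
move=> r nb; rewrite leqNgt; apply/negP => l1.
have e0 : T j p = b by rewrite -[p]addn0 r // ltnW.
have e1 : T j p.+1 = b by rewrite -addn1 r.
have na : T j p != x j by rewrite e0.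
have [p' ep e'] := tail_neq_bpos na.
have := tail_bpos x j p'.+1; rewrite bposS e' na addn2 -ep e1 => e.
by rewrite e eqxx in nb.
Qed.

(** One letter is lost because the last [x j] of the run may open a block of two letters. *)
Lemma run_desubst j p l : run x j p (x j) l.+1 -> exists p', run x j.+1 p' (x j) l.
Proof.
move=> r; have [p' ep] : exists p', p = bpos x j p'.
  by apply: tail_eq_bpos; rewrite -[p]addn0 r.
exists p'; have bp t : t <= l -> bpos x j (p' + t) = p + t.
  elim: t => [|t IH] ht; first by rewrite !addn0.
  by rewrite addnS bposS -tail_bposS IH 1?ltnW // -addnS r // eqxx addn1 addnS.
by move=> t ht; rewrite -tail_bposS bp 1?ltnW // -addnS r.
Qed.

Lemma run_subst j p l : run x j.+1 p (x j) l -> exists p', run x j p' (x j) l.+1.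
Proof.
move=> r; exists (bpos x j p).
have bp t : t <= l -> bpos x j (p + t) = bpos x j p + t.
  elim: t => [|t IH] ht; first by rewrite !addn0.
  by rewrite addnS bposS IH 1?ltnW // r // eqxx addn1 addnS.
by move=> t ht; rewrite -bp // tail_bpos.
Qed.

Lemma letter_occurs j n : exists p, T j p = x (j + n).
Proof.
elim: n j => [|n IH] j; first by exists 0; rewrite addn0 tail0.
by have [p e] := IH j.+1; exists (bpos x j p).+1; rewrite tail_bposS e addSnnS.
Qed.

Lemma size_pal_mono : {mono (fun j => size (pal x j)) : i j / i <= j}.
Proof.
apply: leq_mono; apply: homo_ltn; first exact: ltn_trans.
by move=> j; rewrite size_palS; have := lenPsi_gt0 x j (x j); lia.
Qed.

End Runs.

(** The natural number [B] stands for [b + 1], so that the bound -1 of a formal inverse letter gives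
    the count 0. *)
Lemma card_conjugates (A : finType) (t : nat -> A) (l B : nat) (w : seq A) (b : int) :
  Ppow t (size w) l = conjugates w b -> b = (Posz B - 1)%R ->
  (forall i j, i < B -> j < B -> rot i w = rot j w -> i = j) ->
  ppow t (size w) l = B.
Proof.
move=> e eb inj.
pose f (i : 'I_B) : (size w).-tuple A := [tuple of rot i (in_tuple w)].
have injf : injective f.
  by move=> i j /(congr1 val) /= /inj eij; apply: val_inj; exact: eij.
rewrite -[RHS]card_ord -(card_imset _ injf) /ppow.
apply: eq_card => v; rewrite !inE e; apply/asboolP/imsetP.
- case=> i /= hi ev; have ltB : i < B by move: hi; rewrite eb; lia.
  by exists (Ordinal ltB) => //; apply: val_inj.
- by case=> i _ ->; exists (nat_of_ord i) => //=; rewrite eb; have := ltn_ord i; lia.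
Qed.

(** * The cyclic directive word and the images of letters *)

Section Cyclic.
Variables (k : nat) (hk : 1 < k) (d : nat -> nat).
Hypothesis hd : forall i, 0 < i -> 0 < d i.
Variable x : nat -> 'I_k.
Hypothesis hx : is_directive hk d x.
Implicit Types (b c : 'I_k) (i j l m n p q M N : nat).

Local Notation letter := (letter hk).
Local Notation sw := (sw hk d).
Local Notation sprod := (sprod hk d).
Local Notation Psi := (Psi x).
Local Notation pal := (pal x).
Local Notation lenPsi := (lenPsi x).

(** The level at which the block of [d N.+1] letters [letter N.+1] begins in the directive word. *)
Definition dsum N := \sum_(1 <= i < N.+1) d i.

Lemma dsum0 : dsum 0 = 0. Proof. by rewrite /dsum big_geq. Qed.

Lemma dsumS N : dsum N.+1 = dsum N + d N.+1.
Proof. by rewrite /dsum big_nat_recr. Qed.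

Lemma dsum_mono : {mono dsum : M N / M <= N}.
Proof.
apply: leq_mono; apply: homo_ltn; first exact: ltn_trans.
by move=> N; rewrite dsumS; have := @hd N.+1 isT; lia.
Qed.

Lemma leq_dsum N : N <= dsum N.
Proof. by elim: N => // N IH; rewrite dsumS; have := @hd N.+1 isT; lia. Qed.

Lemma directive_dsum N q : q < d N.+1 -> x (dsum N + q) = letter N.+1.
Proof. exact: hx. Qed.

Lemma letterD N : letter (N + k).+1 = letter N.+1.
Proof. by apply: val_inj; rewrite /= modnDr. Qed.

Lemma letter_neq M N : M < N < M + k -> letter M.+1 != letter N.+1.
Proof.
move=> hMN; apply/eqP => /(congr1 val) /= e.
have : N = M %[mod k] by [].
move/eqP; rewrite eqn_mod_dvd; last lia.
by move=> /dvdn_leq; lia.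
Qed.

(** Either [b] has not been used before block [N], or [M] is the last block that used it. *)
Lemma letter_cases N b : exists2 M, letter M.+1 = b & N <= M < k \/ M < N <= M + k.
Proof.
have [h1|h1] := leqP N b.
  by exists b; [apply: val_inj; rewrite /= modn_small | left; rewrite h1 ltn_ord].
(* The largest index below [N] congruent to [b] modulo [k]. *)
pose M := N.-1 - (N.-1 - b) %% k.
have hm := ltn_pmod (N.-1 - b) (ltnW hk).
have hm2 := leq_mod (N.-1 - b) k.
exists M; last by right; rewrite /M; lia.
apply: val_inj => /=; rewrite -[RHS](modn_small (ltn_ord b)); apply/eqP.
rewrite eqn_mod_dvd /M; last lia.
have -> : N.-1 - (N.-1 - b) %% k - b = (N.-1 - b) - (N.-1 - b) %% k by lia.
by rewrite {1}(divn_eq (N.-1 - b) k) addnK dvdn_mull.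
Qed.

Lemma recurrent b j : exists n, x (j + n) = b.
Proof.
pose M := j * k + b; have hM : j <= dsum M.
  by apply: leq_trans (leq_dsum _); rewrite /M; nia.
exists (dsum M - j); rewrite subnKC // -[dsum M]addn0 directive_dsum ?hd //.
by apply: val_inj; rewrite /= modnMDl modn_small.
Qed.

Lemma sprodS N (c : nat) : sprod N.+1 c.+1 = wpow (sw N) (d N.+1) ++ sprod N c.
Proof.
rewrite /Defs.sprod /= subn0; congr cat.
rewrite -[iota 1 c]/(iota (1 + 0) c) iotaDl -map_comp; congr flatten; apply: eq_map => l /=.
by rewrite add1n subSS (_ : N - l.+1 = N.-1 - l) //; lia.
Qed.

Lemma Psi_same N q : q <= d N.+1 ->
  Psi (dsum N + q) [:: letter N.+1] = Psi (dsum N) [:: letter N.+1].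
Proof.
elim: q => [|q IH] hq; first by rewrite addn0.
by rewrite addnS PsiS directive_dsum // eqxx IH // ltnW.
Qed.

Lemma Psi_other N q b : q <= d N.+1 -> b != letter N.+1 ->
  Psi (dsum N + q) [:: b] = wpow (Psi (dsum N) [:: letter N.+1]) q ++ Psi (dsum N) [:: b].
Proof.
move=> + nb; elim: q => [|q IH] hq; first by rewrite addn0.
rewrite addnS PsiS directive_dsum // (negPf nb) IH 1?ltnW // Psi_same 1?ltnW //.
by rewrite wpowS catA.
Qed.

(** Passing block [N] prefixes s_N^(d_(N+1)) to the image of every letter but its own. The next
    current letter was last used [k] blocks before or, in the first round, never, which gives the
    two recurrences of s_n. *)
Lemma Psi_standard N :
  [/\ Psi (dsum N) [:: letter N.+1] = sw N,
      forall M, M < N <= M + k ->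
        Psi (dsum N) [:: letter M.+1] = sprod N (N - M.+1) ++ sw M
    & forall M, N <= M < k ->
        Psi (dsum N) [:: letter M.+1] = sprod N N ++ [:: letter M.+1]].
Proof.
elim: N => [|N [IHa IHb IHc]]; first by rewrite dsum0; split.
have hb M : M < N.+1 <= M + k ->
    Psi (dsum N.+1) [:: letter M.+1] = sprod N.+1 (N.+1 - M.+1) ++ sw M.
  move=> /andP[h1 h2]; have [eM|nM] := eqVneq M N.
    by rewrite eM dsumS Psi_same // IHa subnn.
  rewrite dsumS Psi_other //; last by apply: letter_neq; lia.
  rewrite IHa IHb; last lia.
  have e : N - M = (N - M.+1).+1 by lia.
  by rewrite subSS e sprodS catA.
have hc M : N.+1 <= M < k ->
    Psi (dsum N.+1) [:: letter M.+1] = sprod N.+1 N.+1 ++ [:: letter M.+1].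
  move=> hM; rewrite dsumS Psi_other //; last by rewrite eq_sym; apply: letter_neq; lia.
  by rewrite IHa IHc ?sprodS -?catA //; lia.
split=> //; have [lt|ge] := ltnP N.+1 k.
  by rewrite hc ?leqnn // sw_small.
have -> : letter N.+2 = letter (N.+1 - k).+1 by rewrite -(letterD (N.+1 - k)) subnK.
rewrite sw_large // hb; last lia.
by congr (sprod _ _ ++ _); lia.
Qed.

(** * Lengths of images and palindromic prefixes *)

Definition slen N := size (sw N).

Lemma lenPsi_dsum N : lenPsi (dsum N) (letter N.+1) = slen N.
Proof. by rewrite /lenPsi; have [-> _ _] := Psi_standard N. Qed.

Lemma slen_gt0 N : 0 < slen N. Proof. by rewrite -lenPsi_dsum lenPsi_gt0. Qed.

Lemma lenPsi_same N q : q <= d N.+1 -> lenPsi (dsum N + q) (letter N.+1) = slen N.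
Proof. by move=> hq; rewrite /lenPsi Psi_same // -lenPsi_dsum. Qed.

Lemma lenPsi_other N q b : q <= d N.+1 -> b != letter N.+1 ->
  lenPsi (dsum N + q) b = q * slen N + lenPsi (dsum N) b.
Proof.
by move=> hq nb; rewrite {1}/lenPsi Psi_other // size_cat size_wpow -lenPsi_dsum.
Qed.

Lemma size_pal_add N q : q <= d N.+1 ->
  size (pal (dsum N + q)) = q * slen N + size (pal (dsum N)).
Proof.
elim: q => [|q IH] hq; first by rewrite addn0.
by rewrite addnS size_palS directive_dsum // lenPsi_same 1?ltnW // IH 1?ltnW // mulSn addnA.
Qed.

Lemma size_pal_dsum N : size (pal (dsum N)) = size (sprod N N).
Proof.
elim: N => [|N IH]; first by rewrite dsum0.
by rewrite dsumS size_pal_add // sprodS size_cat size_wpow IH.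
Qed.

(* |D_M|: the palindromic prefix preceding the last a_(M+1) of its block. *)
Definition lastpal M := size (pal (dsum M + (d M.+1 - 1))).

Lemma Dlen_Posz M : Dlen hk d M = Posz (lastpal M).
Proof.
rewrite /Dlen /= size_cat size_wpow -size_pal_dsum /lastpal size_pal_add //; lia.
Qed.

Lemma lastpal_inj : injective lastpal.
Proof.
suff mono : {mono lastpal : M N / M <= N} by exact: incn_inj.
apply: leq_mono => M N ltMN; rewrite /lastpal ltnNge size_pal_mono -ltnNge.
have := hd (ltn0Sn M); have := hd (ltn0Sn N).
have : dsum M.+1 <= dsum N by rewrite dsum_mono.
by rewrite dsumS; lia.
Qed.

Lemma lenPsi_unseen N M : N <= M < k -> lenPsi (dsum N) (letter M.+1) = (size (pal (dsum N))).+1.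
Proof.
move=> hM; rewrite /lenPsi; have [_ _ ->] // := Psi_standard N.
by rewrite size_cat addn1 size_pal_dsum.
Qed.

(** The last use of the letter lengthens the palindromic prefix [lastpal M] by the image of the
    letter; every later step adds the same length to prefix and image. *)
Lemma lenPsi_seen N M : M < N <= M + k ->
  size (pal (dsum N)) = lenPsi (dsum N) (letter M.+1) + lastpal M.
Proof.
elim: N => // N IH /andP[h1 h2]; have [eM|nM] := eqVneq M N.
  rewrite eM dsumS lenPsi_same // size_pal_add // /lastpal size_pal_add; last lia.
  by have := hd (ltn0Sn N); case: (d N.+1) => // e _; rewrite subSS subn0 mulSn addnA.
rewrite dsumS lenPsi_other //; last by apply: letter_neq; lia.
rewrite size_pal_add // IH; lia.
Qed.

Lemma size_pal_dsum_slen N : (Posz (size (pal (dsum N))) = Posz (slen N) + Dlen hk d (Posz N - Posz k))%R.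
Proof.
have [lt|ge] := ltnP N k.
  have := @lenPsi_unseen N N; rewrite leqnn lt lenPsi_dsum => /(_ isT) ->.
  have [e ->] : exists e, (Posz N - Posz k)%R = Negz e.
    by exists (k - N).-1; rewrite NegzE; lia.
  by rewrite /Dlen /=; lia.
have -> : (Posz N - Posz k)%R = Posz (N - k) by lia.
rewrite Dlen_Posz; have := @lenPsi_seen N (N - k); rewrite -(letterD (N - k)) subnK // lenPsi_dsum => ->; lia.
Qed.

Lemma lenPsi_lt_slen N b : b != letter N.+1 -> lenPsi (dsum N) b <= size (pal (dsum N)) -> lenPsi (dsum N) b < slen N.
Proof.
have [M <- [hM|hM]] := letter_cases N b => nb hb.
  by move: hb; rewrite lenPsi_unseen // ltnn.
have [lt|ge] := ltnP N k.
  by have := @lenPsi_unseen N N; rewrite leqnn lt lenPsi_dsum => /(_ isT) ->.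
have := @lenPsi_seen N (N - k); rewrite -(letterD (N - k)) subnK // lenPsi_dsum => e2.
have e1 := lenPsi_seen hM.
have : lastpal (N - k) < lastpal M.
  rewrite /lastpal ltnNge size_pal_mono -ltnNge.
  have ltM : N - k < M.
    have [eM|nM] := eqVneq M (N - k); last lia.
    by move: nb; rewrite eM -(letterD (N - k)) subnK // eqxx.
  have := hd (ltn0Sn M); have := hd (ltn0Sn (N - k)).
  have : dsum (N - k).+1 <= dsum M by rewrite dsum_mono.
  by rewrite dsumS; lia.
lia.
Qed.

Lemma lenPsi_inj N b c : lenPsi (dsum N) b <= size (pal (dsum N)) -> lenPsi (dsum N) b = lenPsi (dsum N) c -> b = c.
Proof.
have [M <- [hM|hM]] := letter_cases N b; first by rewrite lenPsi_unseen // ltnn.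
have [M' <- [hM'|hM']] := letter_cases N c => hb e.
  by move: hb; rewrite e lenPsi_unseen // ltnn.
have := lenPsi_seen hM; have := lenPsi_seen hM'; rewrite e => e1 e2.
by congr (letter _.+1); apply: lastpal_inj; lia.
Qed.

Lemma letterSS_neq N : letter N.+2 != letter N.+1.
Proof. by rewrite eq_sym; apply: letter_neq; lia. Qed.

Lemma size_pal_dsum_lt N : size (pal (dsum N)) < 2 * slen N.
Proof.
case: N => [|N]; first by rewrite dsum0 muln_gt0 slen_gt0.
have nb : letter N.+1 != letter N.+2 by rewrite eq_sym letterSS_neq.
have hb : lenPsi (dsum N.+1) (letter N.+1) <= size (pal (dsum N.+1)).
  by rewrite (@lenPsi_seen N.+1 N) ?leq_addr //; lia.
have := size_pal_lt_lenPsi2 x (dsum N.+1) nb; have := lenPsi_lt_slen nb hb; rewrite lenPsi_dsum; lia.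
Qed.

Lemma slenS N : slen N.+1 = d N.+1 * slen N + lenPsi (dsum N) (letter N.+2).
Proof. by rewrite -lenPsi_dsum dsumS lenPsi_other // letterSS_neq. Qed.

Lemma slen_mono : {mono slen : M N / M <= N}.
Proof.
apply: leq_mono; apply: homo_ltn; first exact: ltn_trans.
move=> N; rewrite slenS; have := lenPsi_gt0 x (dsum N) (letter N.+2).
have := hd (ltn0Sn N); nia.
Qed.

(** The intervals between consecutive [slen] are disjoint; through them a period determines its
    block. *)
Lemma level_uniq m M N : slen M <= m < slen M.+1 -> slen N <= m < slen N.+1 -> M = N.
Proof.
move=> /andP[h1 h2] /andP[h3 h4].
have := leq_ltn_trans h1 h4; have := leq_ltn_trans h3 h2.
by rewrite !ltnNge !slen_mono -!ltnNge; lia.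
Qed.

Lemma level_power N l : 0 < l <= d N.+1 -> slen N <= l * slen N < slen N.+1.
Proof.
move=> /andP[l0 hl]; rewrite leq_pmull //= slenS.
by have := lenPsi_gt0 x (dsum N) (letter N.+2); nia.
Qed.

(** At the end of the block the image of [letter N.+2] is s_(N+1), of length [slen N.+1], so this
    case belongs to the next interval. *)
Lemma level_letter N q b : 0 < q <= d N.+1 -> b != letter N.+1 ->
  (q = d N.+1 -> b != letter N.+2) -> lenPsi (dsum N + q) b <= size (pal (dsum N + q)) ->
  [/\ lenPsi (dsum N) b <= size (pal (dsum N)), lenPsi (dsum N) b < slen N
    & slen N <= lenPsi (dsum N + q) b < slen N.+1].
Proof.
move=> /andP[q0 hq] nb nb2 hle.
have e := lenPsi_other hq nb; have hb : lenPsi (dsum N) b <= size (pal (dsum N)).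
  by move: hle; rewrite e size_pal_add // leq_add2l.
have lt := lenPsi_lt_slen nb hb; split=> //; apply/andP; split; first by rewrite e; nia.
have [eq|nq] := eqVneq q (d N.+1).
  have := @lenPsi_lt_slen N.+1 b; rewrite dsumS -eq; apply => //; exact: nb2.
by rewrite e slenS; have := lenPsi_gt0 x (dsum N) (letter N.+2); nia.
Qed.

(** * Classification of the squares by their period *)

Lemma run_same_leq N q p l : q <= d N.+1 ->
  run x (dsum N + q) p (letter N.+1) l -> l <= (d N.+1 - q).+1.
Proof.
move=> hq; move e: (d N.+1 - q) => n; elim: n q p l hq e => [|n IH] q p l hq e r.
  have eq : q = d N.+1 by lia.
  apply: (run_neq r); rewrite eq -dsumS -[dsum _]addn0 directive_dsum ?hd // eq_sym.
  exact: letterSS_neq.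
have lq : q < d N.+1 by lia.
case: l r => // l; rewrite -(directive_dsum lq) => /run_desubst[p' r'].
rewrite ltnS; apply: (IH q.+1 p') => //; first lia.
by rewrite addnS -(directive_dsum lq).
Qed.

Lemma run_same_exists N q : q <= d N.+1 ->
  exists p, run x (dsum N + q) p (letter N.+1) (d N.+1 - q).+1.
Proof.
move=> hq; move e: (d N.+1 - q) => n; elim: n q hq e => [|n IH] q hq e.
  have [m em] := recurrent (letter N.+1) (dsum N + q).
  have [p ep] := letter_occurs x (dsum N + q) m.
  by exists p; case=> // _; rewrite addn0 ep em.
have lq : q < d N.+1 by lia.
have [||p] := IH q.+1; try lia.
by rewrite addnS -(directive_dsum lq) => /run_subst.
Qed.

Lemma level_exists j : 0 < j -> exists N q, j = dsum N + q /\ 0 < q <= d N.+1.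
Proof.
elim: j => // j IH _; have [->|j0] := posnP j.
  by exists 0, 1; rewrite dsum0 hd.
have [N [q [e /andP[q0 hq]]]] := IH j0.
have [lt|ge] := ltnP q (d N.+1); first by exists N, q.+1; rewrite e addnS.
exists N.+1, 1; rewrite hd // dsumS; lia.
Qed.

(** Powers of s_N are moved to the last level of the block that still has runs of length [l], where
    the window is widest. At the end of a block, [letter N.+2] counts as the current letter of block
    [N.+1]. *)
Lemma square_cases m w : 0 < m -> Ppow (tail x 0) m 2 w ->
  (exists N l i, [/\ 0 < l <= d N.+1, m = l * slen N,
     i + m <= size (pal (dsum N + (d N.+1 + 1 - l)))
     & w = rot (i %% slen N) (wpow (sw N) l)]) \/
  (exists N q b i, [/\ 0 < q <= d N.+1, b != letter N.+1,
     q = d N.+1 -> b != letter N.+2,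
     m = lenPsi (dsum N + q) b /\ i + m <= size (pal (dsum N + q))
     & w = rot (i %% m) (Psi (dsum N + q) [:: b])]).
Proof.
move=> m0 /(square_elim recurrent m0)[j [p [b [l [i [r l0 em hi ew]]]]]].
have j0 : 0 < j by case: j hi {r em ew} => //=; lia.
have [N [q [ej /andP[q0 hq]]]] := level_exists j0; subst j.
have [eb|nb] := eqVneq b (letter N.+1).
  left; exists N, l, i; move: r em ew; rewrite eb lenPsi_same // Psi_same // => r em ew.
  have hl := run_same_leq hq r; split=> //; first lia.
    by apply: leq_trans hi _; rewrite size_pal_mono; lia.
  by have [<- _ _] := Psi_standard N.
have B : l <= 1 -> (q = d N.+1 -> b != letter N.+2) -> exists N0 q0 b0 i0,
    [/\ 0 < q0 <= d N0.+1, b0 != letter N0.+1, q0 = d N0.+1 -> b0 != letter N0.+2,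
     m = lenPsi (dsum N0 + q0) b0 /\ i0 + m <= size (pal (dsum N0 + q0))
     & w = rot (i0 %% m) (Psi (dsum N0 + q0) [:: b0])].
  move=> l1 nb2; have el : l = 1 by lia.
  rewrite el mul1n in em; rewrite el wpow1 -em in ew.
  by exists N, q, b, i; split=> //; rewrite q0.
have [eq|nq] := eqVneq q (d N.+1); last first.
  right; apply: B => [|/eqP]; last by rewrite (negPf nq).
  by apply: (run_neq r); rewrite directive_dsum // ltn_neqAle nq.
have xj : x (dsum N + q) = letter N.+2.
  by rewrite eq -dsumS -[dsum _]addn0 directive_dsum ?hd.
have [eb|nb2] := eqVneq b (letter N.+2); last first.
  by right; apply: B => //; apply: (run_neq r); rewrite xj.
left; move: r em ew hi; rewrite eb eq -dsumS lenPsi_dsum // => r em ew hi.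
have l1 : l = 1.
  have := size_pal_dsum_lt N.+1.
  have := leq_trans (leq_addl i m) hi; have := slen_gt0 N.+1; rewrite em; nia.
exists N.+1, l, i; split=> //.
- by rewrite l1 hd.
- by apply: leq_trans hi _; rewrite size_pal_mono; lia.
by have [<- _ _] := Psi_standard N.+1.
Qed.

Lemma Ppow_power n r w : 0 < r <= d n.+1 ->
  Ppow (tail x 0) (r * slen n) 2 w <->
  exists2 i, i + r * slen n <= size (pal (dsum n + (d n.+1 + 1 - r)))
    & w = rot (i %% slen n) (wpow (sw n) r).
Proof.
move=> hr; have H0 := slen_gt0 n; split; last first.
  case=> i hi ->.
  have hq : d n.+1 + 1 - r <= d n.+1 by lia.
  have [p] := run_same_exists hq.
  have -> : (d n.+1 - (d n.+1 + 1 - r)).+1 = r by lia.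
  move=> rn; have := @square_intro _ x (dsum n + (d n.+1 + 1 - r)) p (letter n.+1) r i rn.
  rewrite lenPsi_same // Psi_same //; have [-> _ _] := Psi_standard n.
  by apply=> //; lia.
have m0 : 0 < r * slen n by nia.
move=> /(square_cases m0)[[N [l [i [hl em hi ew]]]]|[N [q [b [i [hq nb nb2 [em hi] _]]]]]].
  have eN : n = N.
    by apply: (@level_uniq (r * slen n)); rewrite ?level_power // em level_power.
  subst N; move/eqP: em; rewrite eqn_pmul2r // => /eqP er; subst l.
  by exists i.
exfalso; rewrite em in hi.
have [h1 h2 h3] := level_letter hq nb nb2 (leq_trans (leq_addl i _) hi).
have eN : n = N by apply: (@level_uniq (r * slen n)); rewrite ?level_power // em.
(* Modulo [slen n] the left side vanishes, while the right side leaves the positive remainder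
   [lenPsi (dsum n) b]. *)
subst N; move: em; rewrite lenPsi_other //; last by case/andP: hq.
move=> /(congr1 (fun m => m %% slen n)); rewrite modnMl modnMDl modn_small //.
by have := lenPsi_gt0 x (dsum n) b; lia.
Qed.

Lemma size_pal_lt_double n r b : 0 < r <= d n.+1 -> b != letter n.+1 ->
  size (pal (dsum n + r)) < 2 * lenPsi (dsum n + r) b.
Proof.
move=> /andP[r0 hr] nb; rewrite lenPsi_other // size_pal_add //.
by have := size_pal_lt_lenPsi2 x (dsum n) nb; rewrite lenPsi_dsum; nia.
Qed.

Lemma Ppow_letter n r b w : 0 < r <= d n.+1 -> b != letter n.+1 ->
  (r = d n.+1 -> b != letter n.+2) -> lenPsi (dsum n + r) b <= size (pal (dsum n + r)) ->
  Ppow (tail x 0) (lenPsi (dsum n + r) b) 2 w <->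
  exists2 i, i + lenPsi (dsum n + r) b <= size (pal (dsum n + r))
    & w = rot i (Psi (dsum n + r) [:: b]).
Proof.
move=> hr nb nb2 hle; have m0 := lenPsi_gt0 x (dsum n + r) b.
have small i : i + lenPsi (dsum n + r) b <= size (pal (dsum n + r)) -> i %% lenPsi (dsum n + r) b = i.
  by move=> hi; apply: modn_small; have := size_pal_lt_double hr nb; lia.
split; last first.
  case=> i hi ->; have [n' en'] := recurrent b (dsum n + r).
  have [p ep] := letter_occurs x (dsum n + r) n'.
  have rn : run x (dsum n + r) p b 1 by case=> // _; rewrite addn0 ep.
  by have := square_intro (i := i) rn isT; rewrite mul1n wpow1 small // => /(_ hi).
have [h1 h2 h3] := level_letter hr nb nb2 hle.
move=> /(square_cases m0)[[N [l [i [hl em hi ew]]]]|[N [q [c [i [hq nc nc2 [em hi] ew]]]]]].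
  exfalso; have eN : n = N.
    by apply: (@level_uniq (lenPsi (dsum n + r) b)) => //; rewrite em level_power.
  subst N; move: em; rewrite lenPsi_other //; last by case/andP: hr.
  move=> /(congr1 (fun m => m %% slen n)); rewrite modnMl modnMDl modn_small //.
  by have := lenPsi_gt0 x (dsum n) b; lia.
have hi2 := hi; rewrite em in hi2.
have [h1' h2' h3'] := level_letter hq nc nc2 (leq_trans (leq_addl i _) hi2).
have eN : n = N by apply: (@level_uniq (lenPsi (dsum n + r) b)); rewrite // em.
subst N; case/andP: (hr) => _ hr'; case/andP: (hq) => _ hq'.
have H0 := slen_gt0 n.
have e := em; rewrite !lenPsi_other // in e.
(* Dividing the period by [slen n], the quotient gives the exponent and the remainder gives the
   letter. *)
have eq : r = q.
  have := congr1 (fun m => m %/ slen n) e.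
  by rewrite !divnMDl // !divn_small // !addn0.
subst q; have ec : b = c by apply: (@lenPsi_inj n) => //; move/addnI: e.
by subst c; exists i => //; rewrite ew small.
Qed.

(** * Distinct conjugates and the two families of squares *)

Lemma conj_power_inj n r i j : 0 < r -> i < slen n -> j < slen n ->
  rot i (wpow (sw n) r) = rot j (wpow (sw n) r) -> i = j.
Proof.
case: r => // r _ hi hj; rewrite !rot_wpow; try exact: ltnW.
move=> /(congr1 (take (slen n))); rewrite !wpowS !take_size_cat ?size_rot //.
have [<- _ _] := Psi_standard n.
by apply: primitive_rot_inj; rewrite ?[size _]lenPsi_dsum //; exact: primitive_Psi.
Qed.

Lemma squares_power n r : 0 < r <= d n.+1 ->
  let w := wpow (sw n) r in
  [/\ r.*2 < 2 + d n.+1 ->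
        Ppow (tail x 0) (size w) 2 = conjugates w (Posz (slen n) - 1)%R /\
        ppow (tail x 0) (size w) 2 = slen n,
      ~~ odd (d n.+1) -> r = 1 + (d n.+1)./2 ->
        Ppow (tail x 0) (size w) 2 = conjugates w (Dlen hk d (Posz n - Posz k)%R) /\
        (Posz (ppow (tail x 0) (size w) 2) = Dlen hk d (Posz n - Posz k) + 1)%R
    & 2 + d n.+1 < r.*2 ->
        Ppow (tail x 0) (size w) 2 = set0 /\ ppow (tail x 0) (size w) 2 = 0].
Proof.
move=> hr w; have sw' : size w = r * slen n by rewrite size_wpow.
case/andP: (hr) => r0 hr'; have H0 := slen_gt0 n.
(* An offset i is admissible when it is at most (d_(n+1) + 1 - 2r)|s_n| + |u|, where u is
   [pal (dsum n)] and |s_n| - 1 <= |u| < 2|s_n|. The three cases are those of a coefficient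
   nonnegative, equal to -1, and at most -2. *)
have ep : size (pal (dsum n + (d n.+1 + 1 - r))) = (d n.+1 + 1 - r) * slen n + size (pal (dsum n)).
  by apply: size_pal_add; lia.
have eD := size_pal_dsum_slen n; have lt2 := size_pal_dsum_lt n.
split.
- move=> h2.
  have hp : slen n <= (size (pal (dsum n))).+1.
    have [lt|ge] := ltnP n k; first by have := @lenPsi_unseen n n; rewrite leqnn lt lenPsi_dsum => ->.
    have -> : (size (pal (dsum n))).+1 = (lenPsi (dsum n) (letter n.+1) + lastpal (n - k)).+1.
      by have := @lenPsi_seen n (n - k); rewrite -(letterD (n - k)) subnK // => -> //; lia.
    by rewrite lenPsi_dsum; lia.
  have eP : Ppow (tail x 0) (size w) 2 = conjugates w (Posz (slen n) - 1)%R.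
    rewrite sw'; apply/seteqP; split=> v.
      case/(Ppow_power _ hr) => i _ ->; exists (i %% slen n) => //=.
      by have := ltn_pmod i H0; lia.
    case=> i /= hi <-; apply/(Ppow_power _ hr); exists i; last by rewrite modn_small //; lia.
    rewrite ep; nia.
  split=> //; apply: (card_conjugates eP) => // i j hi hj.
  exact: conj_power_inj.
- move=> od er; have ed : d n.+1 + 1 - r = r - 1.
    have := odd_double_half (d n.+1); rewrite (negPf od) er; lia.
  have e2 : (r - 1) * slen n + slen n = r * slen n by nia.
  have eP : Ppow (tail x 0) (size w) 2 = conjugates w (Dlen hk d (Posz n - Posz k)%R).
    rewrite sw'; apply/seteqP; split=> v.
      case/(Ppow_power _ hr) => i; rewrite ep ed => hi ->.
      exists i => /=; last by rewrite modn_small //; lia.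
      by lia.
    case=> i /= hi <-; apply/(Ppow_power _ hr); exists i; last by rewrite modn_small //; lia.
    by rewrite ep ed; lia.
  split=> //; pose B := `|(Dlen hk d (Posz n - Posz k) + 1)%R|%N.
  have D1 : (-1 <= Dlen hk d (Posz n - Posz k))%R.
    by rewrite /Dlen; case: (D _ _ _) => //= v; lia.
  have eB : (Dlen hk d (Posz n - Posz k) = Posz B - 1)%R by rewrite /B; lia.
  rewrite (card_conjugates eP eB); first lia.
  by move=> i j hi hj; apply: conj_power_inj => //; lia.
move=> h2; have eP : Ppow (tail x 0) (size w) 2 = conjugates w (-1)%R.
  rewrite sw'; apply/seteqP; split=> v; last by case=> i /=; lia.
  by case/(Ppow_power _ hr) => i; rewrite ep; nia.
have e0 : conjugates w (-1)%R = set0 by apply/seteqP; split=> v // -[i /=]; lia.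
by split; [rewrite eP | apply: (card_conjugates eP)].
Qed.

Lemma squares_letter n r i : 0 < r <= d n.+1 -> 2 <= i <= k ->
  (i = k -> r <> d n.+1) -> (n.+1 < i -> d n.+1 <= r.*2 /\ r < d n.+1) ->
  let v := vword hk d n r i in
  Ppow (tail x 0) (size v) 2 = conjugates v (Dlen hk d (Posz n + 1 - Posz i)%R) /\
  (Posz (ppow (tail x 0) (size v) 2) = Dlen hk d (Posz n + 1 - Posz i) + 1)%R.
Proof.
move=> hr /andP[i2 ik] nik hni v; case/andP: (hr) => r0 hr'.
(* For a negative index, |v| is the length of s_n^(r+1), and [Ppow_power] leaves no admissible
   offset. *)
have [lt|ge] := ltnP n.+1 i.
  have [h2 rd] := hni lt; have nk : n < k by lia.
  have [e en] : exists e, (Posz n + 1 - Posz i)%R = Negz e.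
    by exists (i - n.+2); rewrite NegzE; lia.
  have HJ : slen n = (size (pal (dsum n))).+1 by have := @lenPsi_unseen n n; rewrite leqnn nk lenPsi_dsum => ->.
  have sv : size v = r.+1 * slen n.
    rewrite /v /vword en /= !size_cat size_wpow (minn_idPr _); last lia.
    by rewrite -size_pal_dsum /= addn1 -HJ mulSn addnC.
  have eP : Ppow (tail x 0) (size v) 2 = conjugates v (-1)%R.
    rewrite sv; apply/seteqP; split=> u; last by case=> t /=; lia.
    have hr1 : 0 < r.+1 <= d n.+1 by [].
    case/(Ppow_power _ hr1) => t; rewrite size_pal_add; last lia.
    by nia.
  rewrite en; split=> //.
  by rewrite (card_conjugates (B := 0) eP).
(* Otherwise [v] is the image of the letter last used in block [M], and the offsets run up to
   [lastpal M]. *)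
have [M eM] : exists M, n.+1 = M + i by exists (n.+1 - i); lia.
have -> : (Posz n + 1 - Posz i)%R = Posz M by lia.
rewrite Dlen_Posz.
have nb : letter M.+1 != letter n.+1 by apply: letter_neq; lia.
have nb2 : r = d n.+1 -> letter M.+1 != letter n.+2.
  move=> er; apply: letter_neq; have : i != k by apply/eqP => /nik.
  lia.
have ev : v = Psi (dsum n + r) [:: letter M.+1].
  have [ea eb _] := Psi_standard n.
  rewrite Psi_other // ea eb; last lia.
  rewrite /v /vword (minn_idPl _); last lia.
  have -> : (Posz n + 1 - Posz i)%R = Posz M by lia.
  by have -> : n - M.+1 = i - 2 by lia.
have sv : size v = lenPsi (dsum n + r) (letter M.+1) by rewrite ev.
have es : size (pal (dsum n + r)) = lenPsi (dsum n + r) (letter M.+1) + lastpal M.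
  rewrite lenPsi_other // size_pal_add // (@lenPsi_seen n M) ?addnA //; lia.
have hle : lenPsi (dsum n + r) (letter M.+1) <= size (pal (dsum n + r)) by rewrite es leq_addr.
have eP : Ppow (tail x 0) (size v) 2 = conjugates v (Posz (lastpal M)).
  rewrite sv; apply/seteqP; split=> u.
    case/(Ppow_letter _ hr nb nb2 hle) => t; rewrite es => ht ->.
    by exists t; rewrite ?ev //=; lia.
  case=> t /= ht <-; apply/(Ppow_letter _ hr nb nb2 hle).
  by exists t; rewrite ?ev // es; lia.
split=> //; rewrite (card_conjugates (B := (lastpal M).+1) eP); [lia|lia|].
have ltv : lastpal M < size v.
  by have := size_pal_lt_double hr nb; rewrite es sv; lia.
move=> t t' ht ht'; apply: primitive_rot_inj; try exact: leq_trans ltv.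
by rewrite ev; exact: primitive_Psi.
Qed.

End Cyclic.

Theorem theorem6p13 (k : nat) (hk : 1 < k)
    (d : nat -> nat) (hd : forall i, 0 < i -> 0 < d i)
    (x s : nat -> 'I_k)
    (hx : is_directive hk d x) (hs : standard_episturmian x s)
    (n r : nat) (hn : 0 < n) (hr : 0 < r) :
  (* (i) *)
  (r <= d n.+1 ->
    let w := wpow (sw hk d n) r in
    [/\ (* 1 <= r < 1 + d_(n+1)/2 *)
        r.*2 < 2 + d n.+1 ->
          Ppow s (size w) 2 = conjugates w ((size (sw hk d n))%:Z - 1)%R /\
          ppow s (size w) 2 = size (sw hk d n),
        (* d_(n+1) even and r = 1 + d_(n+1)/2 *)
        ~~ odd (d n.+1) -> r = 1 + (d n.+1)./2 ->
          Ppow s (size w) 2 = conjugates w (Dlen hk d (n%:Z - k%:Z)%R) /\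
          ((ppow s (size w) 2)%:Z = Dlen hk d (n%:Z - k%:Z) + 1)%R
      & (* 1 + d_(n+1)/2 < r <= d_(n+1) *)
        2 + d n.+1 < r.*2 ->
          Ppow s (size w) 2 = set0 /\ ppow s (size w) 2 = 0])
  /\
  (* (ii); the last hypothesis, void when n + 1 - i >= 0, removes the instances
     with n + 1 - i < 0 at which the claim contradicts (i), because there
     |v| = |s_n^(r+1)|, which is |s_(n+1)| when r = d_(n+1). *)
  (forall i : nat, r <= d n.+1 -> 2 <= i <= k ->
    (i = k -> r <> d n.+1) ->
    (n.+1 < i -> d n.+1 <= r.*2 /\ r < d n.+1) ->
    let v := vword hk d n r i in
    Ppow s (size v) 2 = conjugates v (Dlen hk d (n%:Z + 1 - i%:Z)%R) /\
    ((ppow s (size v) 2)%:Z = Dlen hk d (n%:Z + 1 - i%:Z) + 1)%R).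
Proof.
have es : s = tail x 0 by apply/funext => i; exact: standard_episturmian_tail.
rewrite es; split=> [hr'|i hr' hi hik hni].
  by apply: (squares_power hd hx); rewrite hr.
by apply: (squares_letter hd hx) => //; rewrite hr.
Qed.
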